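(* Let $k$ be an algebraically closed field of characteristic zero, let $V$ be a $k$-vector space of finite dimension $d\ge 1$, and let $\mathcal{M}=\mathrm{Hom}_k(V\otimes V,V)$. Then a generic algebra $(V,m)$ is left-simple and right-simple; that is, there is a nonempty Zariski-open subset $U\subset\mathcal{M}$ such that for every $m\in U$ the algebra $(V,m)$ is both left-simple and right-simple.
   Context: An element $m\in\mathcal{M}$ is viewed as a bilinear multiplication on $V$, and $(V,m)$ denotes the corresponding (not necessarily associative, not necessarily unital) algebra. A left ideal of $(V,m)$ is a subspace $W\subseteq V$ with $m(V,W)\subseteq W$; a right ideal is a subspace $W$ with $m(W,V)\subseteq W$. The algebra $(V,m)$ is left-simple (resp. right-simple) if it has no left (resp. right) ideals other than $0$ and $V$. For $v\in V$ put $l_v=m(v,-)$ and $r_v=m(-,v)$ in $\mathrm{End}_k(V)$; equivalently, $V$ is a simple module over the associative algebra generated by all $l_v$ (resp. all $r_v$), $v\in V$. *)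

(* Defs.v *)
From HB Require Import structures.
From mathcomp Require Import all_boot all_order all_algebra.
From mathcomp Require Import mpoly.

Set Implicit Arguments.
Unset Strict Implicit.
Unset Printing Implicit Defensive.

Import GRing.Theory.

Local Open Scope ring_scope.

(* Another choice of basis changes the coordinates by an invertible linear
   substitution, so [zariski_closed] does not depend on [vbasis]. *)
Definition coords (k : fieldType) (M : vectType k) (x : M) :
    'I_(\dim {:M}) -> k :=
  fun i => coord (vbasis {:M}) i x.

Definition zariski_closed (k : fieldType) (M : vectType k) (Z : M -> Prop) :
    Prop :=
  exists S : {mpoly k[\dim {:M}]} -> Prop,
    forall x : M, Z x <-> (forall p, S p -> p.@[coords x] = 0).

Definition zariski_open (k : fieldType) (M : vectType k) (U : M -> Prop) :
    Prop :=
  zariski_closed (fun x => ~ U x).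

(* Hom(V (x) V, V) in curried form, through the universal property of the
   tensor product: [m v w] is the value of the multiplication at v (x) w. *)
Definition multiplication (k : fieldType) (V : vectType k) : vectType k :=
  'Hom(V, 'Hom(V, V)).

Section Ideals.
Variables (k : fieldType) (V : vectType k) (m : multiplication V).

Definition left_ideal (W : {vspace V}) : Prop :=
  forall v w : V, w \in W -> m v w \in W.

Definition right_ideal (W : {vspace V}) : Prop :=
  forall v w : V, w \in W -> m w v \in W.

Definition left_simple : Prop :=
  forall W : {vspace V}, left_ideal W -> W = 0%VS \/ W = fullv.

Definition right_simple : Prop :=
  forall W : {vspace V}, right_ideal W -> W = 0%VS \/ W = fullv.

End Ideals.

Lemma multiplicationP (k : fieldType) (V : vectType k) (b : V -> V -> V) :
    (forall v, linear (b v)) -> (forall w, linear (b^~ w)) ->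
  exists! m : multiplication V, forall v w, m v w = b v w.
Proof.
move=> bl br.
pose bv v : {linear V -> V} :=
  HB.pack (b v) (GRing.isLinear.Build _ _ _ _ (b v) (bl v)).
have lin : linear (fun v => linfun (bv v)).
  move=> a x y; apply/lfunP => w.
  by rewrite add_lfunE scale_lfunE !lfunE /=; apply: br.
pose bm : {linear V -> 'Hom(V, V)} :=
  HB.pack (fun v => linfun (bv v)) (GRing.isLinear.Build _ _ _ _ _ lin).
exists (linfun bm); split=> [v w|m' Hm']; first by rewrite !lfunE.
by apply/lfunP => v; apply/lfunP => w; rewrite Hm' !lfunE.
Qed.

(* Main.v *)
Require Import Defs.
From HB Require Import structures.
From mathcomp Require Import all_boot all_order all_algebra.
From mathcomp Require Import mpoly.

(** For operators A and B on V, let f send a d x d matrix X to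
    \sum_(i, j) X_ij A^i B A^j.  If \det f != 0, then the words A^i B A^j span
    End(V), so that every subspace stable under A and B is 0 or V.  For
    A = l_x, B = l_y, and for A = r_x, B = r_y, this determinant is a polynomial
    in m, so it is enough to find one m at which both determinants are nonzero.
    Take the commutative product on a basis indexed by Z/d with
    e_i e_j = e_(i+j+1) if i = 0 or j = 0 and e_i e_j = 0 otherwise: l_(e_0) is
    the cyclic shift and l_(e_1) has rank one, so the words A^i B A^j are,
    up to order, the matrix units. *)

Set Implicit Arguments.
Unset Strict Implicit.
Unset Printing Implicit Defensive.

Import GRing.Theory.

Local Open Scope ring_scope.

(** * Polynomial functions on a vector space and their nonvanishing loci *)

Section PolynomialFunctions.
Context {k : fieldType} {M : vectType k}.

Definition polynomial_function (f : M -> k) : Prop :=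
  exists p : {mpoly k[\dim {:M}]}, forall x, f x = p.@[coords x].

Lemma polynomial_function_const c : polynomial_function (fun=> c).
Proof. by exists c%:MP => x; rewrite mevalC. Qed.

Lemma polynomial_functionD f g :
  polynomial_function f -> polynomial_function g ->
  polynomial_function (fun x => f x + g x).
Proof. by move=> [p fp] [q gq]; exists (p + q) => x; rewrite mevalD fp gq. Qed.

Lemma polynomial_functionM f g :
  polynomial_function f -> polynomial_function g ->
  polynomial_function (fun x => f x * g x).
Proof. by move=> [p fp] [q gq]; exists (p * q) => x; rewrite mevalM fp gq. Qed.

Lemma polynomial_function_ext f g :
  f =1 g -> polynomial_function f -> polynomial_function g.
Proof. by move=> fg [p fp]; exists p => x; rewrite -fg. Qed.

Lemma polynomial_function_sum (I : Type) (r : seq I) (F : I -> M -> k) :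
  (forall i, polynomial_function (F i)) ->
  polynomial_function (fun x => \sum_(i <- r) F i x).
Proof.
move=> FP; elim: r => [|i r IH].
  by apply: polynomial_function_ext (polynomial_function_const 0) => x;
    rewrite big_nil.
by apply: polynomial_function_ext (polynomial_functionD (FP i) IH) => x;
  rewrite big_cons.
Qed.

Lemma polynomial_function_prod (I : Type) (r : seq I) (F : I -> M -> k) :
  (forall i, polynomial_function (F i)) ->
  polynomial_function (fun x => \prod_(i <- r) F i x).
Proof.
move=> FP; elim: r => [|i r IH].
  by apply: polynomial_function_ext (polynomial_function_const 1) => x;
    rewrite big_nil.
by apply: polynomial_function_ext (polynomial_functionM (FP i) IH) => x;
  rewrite big_cons.
Qed.

(** In the coordinates of [vbasis], a linear form is the polynomial of degree at most one whose
    coefficients are its values on that basis. *)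
Lemma polynomial_function_linear (f : M -> k) :
  scalar f -> polynomial_function f.
Proof.
move=> lin_f.
pose g : {scalar M} := HB.pack f (GRing.isLinear.Build _ _ _ _ f lin_f).
exists (\sum_(i < \dim {:M}) (f (vbasis {:M})`_i)%:MP * 'X_i) => x.
rewrite -[f]/(g : M -> k) {1}(coord_vbasis (memvf x)) linear_sum [RHS]raddf_sum.
by apply: eq_bigr => i _; rewrite linearZ /= mevalM mevalC mevalXU mulrC.
Qed.

Definition polynomial_matrix m n (A : M -> 'M[k]_(m, n)) : Prop :=
  forall i j, polynomial_function (fun x => A x i j).

Lemma polynomial_matrixM m n p (A : M -> 'M_(m, n)) (B : M -> 'M_(n, p)) :
  polynomial_matrix A -> polynomial_matrix B ->
  polynomial_matrix (fun x => A x *m B x).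
Proof.
move=> PA PB i j.
pose F l x := A x i l * B x l j.
apply: (@polynomial_function_ext (fun x => \sum_l F l x)) => [x|].
  by rewrite mxE.
by apply: polynomial_function_sum => l; apply: polynomial_functionM.
Qed.

Lemma polynomial_matrixX n (A : M -> 'M_n) r :
  polynomial_matrix A -> polynomial_matrix (fun x => A x ^+ r).
Proof.
move=> PA; elim: r => [|r IH] i j.
  by apply: polynomial_function_ext (polynomial_function_const (1%:M i j)).
have := polynomial_matrixM PA IH i j.
by apply: polynomial_function_ext => x; rewrite exprS.
Qed.

Lemma polynomial_function_det n (A : M -> 'M_n) :
  polynomial_matrix A -> polynomial_function (fun x => \det (A x)).
Proof.
(* Leibniz formula: a signed sum over permutations of products of entries. *)
move=> PA; apply: polynomial_function_sum => s.
apply: polynomial_functionM; first exact: polynomial_function_const.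
by apply: polynomial_function_prod => i; apply: PA.
Qed.

Lemma zariski_open_neq0 (f : M -> k) :
  polynomial_function f -> zariski_open (fun x => f x != 0).
Proof.
(* The complement is the zero locus of [p] alone; [eq p] is the singleton of [p]. *)
move=> [p fp]; exists (eq p) => x; split.
  by move=> /negP; rewrite negbK => /eqP fx _ <-; rewrite -fp.
by move=> /(_ p erefl); rewrite -fp => ->; rewrite eqxx.
Qed.

End PolynomialFunctions.

(** * Words in two matrices and the determinant that detects when they span *)

Section Words.
Context {k : fieldType} {n : nat}.
Implicit Types (A B X : 'M[k]_n).

Definition word_sum A B X : 'M[k]_n :=
  \sum_i \sum_j X i j *: (A ^+ i *m B *m A ^+ j).

Lemma word_sum_is_linear A B : linear (word_sum A B).
Proof.
move=> a X Y; rewrite /word_sum scaler_sumr -big_split; apply: eq_bigr => i _.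
rewrite scaler_sumr -big_split; apply: eq_bigr => j _.
by rewrite !mxE scalerDl scalerA.
Qed.

HB.instance Definition _ A B :=
  GRing.isLinear.Build k 'M[k]_n 'M[k]_n _ (word_sum A B)
    (word_sum_is_linear A B).

Definition word_det A B : k := \det (lin_mx (word_sum A B)).

Lemma word_det_neq0 A B :
  (forall X, word_sum A B X = 0 -> X = 0) -> word_det A B != 0.
Proof.
move=> inj; rewrite -unitfE -[_ \is a _]/(_ \in unitmx) -row_free_unit.
apply: inj_row_free => v; rewrite -[v]vec_mxK mul_vec_lin => /eqP.
by rewrite mxvec_eq0 => /eqP /inj ->; rewrite linear0.
Qed.

Lemma word_sum_surj A B Y : word_det A B != 0 -> exists X, Y = word_sum A B X.
Proof.
rewrite -unitfE -[_ \is a _]/(_ \in unitmx) => uAB.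
exists (vec_mx (mxvec Y *m invmx (lin_mx (word_sum A B)))).
by apply: (can_inj mxvecK); rewrite -mul_vec_lin vec_mxK mulmxKV.
Qed.

Lemma word_det_polynomial (M : vectType k) (A B : M -> 'M[k]_n) :
  polynomial_matrix A -> polynomial_matrix B ->
  polynomial_function (fun x => word_det (A x) (B x)).
Proof.
move=> PA PB; apply: polynomial_function_det => p q.
(* Row [p] of [lin_mx] is the image of the matrix unit [X], which does not depend on the point of
   [M]; column [q] picks the entry [(a, b)] of that image. *)
pose X : 'M[k]_n := vec_mx (delta_mx 0 p).
case/mxvec_indexP: q => a b.
pose F i j x := X i j * (A x ^+ i *m B x *m A x ^+ j) a b.
apply: (@polynomial_function_ext _ _ (fun x => \sum_i \sum_j F i j x)) => [x|].
  rewrite !mxE mxvecE /= summxE; apply: eq_bigr => i _.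
  by rewrite summxE; apply: eq_bigr => j _; rewrite [RHS]mxE.
apply: polynomial_function_sum => i; apply: polynomial_function_sum => j.
apply: polynomial_functionM; first exact: polynomial_function_const.
apply: polynomial_matrixM; last exact: polynomial_matrixX.
by apply: polynomial_matrixM; first exact: polynomial_matrixX.
Qed.

End Words.

(** * From spanning words to the absence of proper stable subspaces *)

Section Simplicity.
Context {k : fieldType} {V : vectType k} {n : nat} (e : n.-tuple V).
Hypothesis e_basis : basis_of {:V} e.

(* [passmx.rVof] and [passmx.vecof] ask for the size of the basis to be
   literally [\dim {:V}]. *)
Definition coord_row (v : V) : 'rV[k]_n := \row_i coord e i v.

Definition coord_vec (u : 'rV[k]_n) : V := \sum_i u 0 i *: e`_i.

Lemma coord_vec_is_linear : linear coord_vec.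
Proof.
move=> a u v; rewrite /coord_vec scaler_sumr -big_split.
by apply: eq_bigr => i _; rewrite !mxE scalerDl scalerA.
Qed.

HB.instance Definition _ :=
  GRing.isLinear.Build k 'rV[k]_n V _ coord_vec coord_vec_is_linear.

Lemma coord_rowK : cancel coord_row coord_vec.
Proof.
move=> v; rewrite [v in RHS](coord_basis e_basis (memvf v)).
by apply: eq_bigr => i _; rewrite mxE.
Qed.

Lemma coord_vecK : cancel coord_vec coord_row.
Proof.
move=> u; apply/rowP => i; rewrite mxE coord_sum_free //.
exact: basis_free e_basis.
Qed.

Lemma coord_row_eq0 v : (coord_row v == 0) = (v == 0).
Proof.
apply/eqP/eqP => [v0|->]; last by apply/rowP => i; rewrite !mxE linear0.
by rewrite -(coord_rowK v) v0 linear0.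
Qed.

(** This matrix acts on coordinate rows from the right, so a product applies its left factor first.
    Taking [g] as a bare function allows [m^~ x] as an argument. *)
Definition op_mx (g : V -> V) : 'M[k]_n := \matrix_(i, j) coord e j (g e`_i).

Lemma op_mxP (g : V -> V) : linear g ->
  forall w, coord_row w *m op_mx g = coord_row (g w).
Proof.
move=> lin_g w.
pose g' : {linear V -> V} := HB.pack g (GRing.isLinear.Build _ _ _ _ g lin_g).
apply/rowP => j; rewrite !mxE.
rewrite [in RHS](coord_basis e_basis (memvf w)) -[g]/(g' : V -> V).
rewrite !linear_sum; apply: eq_bigr => i _.
by rewrite !mxE linearZ linearZ.
Qed.

Lemma stable_trivial (g h : V -> V) (W : {vspace V}) :
  linear g -> linear h -> word_det (op_mx g) (op_mx h) != 0 ->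
  (forall w, w \in W -> g w \in W) -> (forall w, w \in W -> h w \in W) ->
  W = 0%VS \/ W = fullv.
Proof.
move=> lin_g lin_h det_n0 Wg Wh.
have [-> | [w Ww w_n0]] : W = 0%VS \/ exists2 w, w \in W & w != 0.
- have [->|W_n0] := eqVneq W 0%VS; [by left | right].
  by exists (vpick W); rewrite ?memv_pick ?vpick0.
- by left.
right; apply/vspaceP => v; rewrite memvf.
(* The matrices preserving [W] are closed under products, so they contain all words in the two
   operators. *)
pose in_W (X : 'M[k]_n) :=
  forall w, w \in W -> coord_vec (coord_row w *m X) \in W.
have in_W_op f : linear f -> (forall w, w \in W -> f w \in W) ->
    in_W (op_mx f).
  by move=> lin_f Wf w' Ww'; rewrite op_mxP // coord_rowK; apply: Wf.
have in_W_mul X Y : in_W X -> in_W Y -> in_W (X *m Y).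
  by move=> WX WY w' /WX /WY; rewrite coord_vecK mulmxA.
have in_W_exp X r : in_W X -> in_W (X ^+ r).
  move=> WX; elim: r => [w' Ww'|r IH]; first by rewrite mulmx1 coord_rowK.
  by rewrite exprS; apply: in_W_mul.
(* A nonzero row has a right inverse, so some matrix sends [w] to the arbitrary vector [v]; being a
   combination of words, it keeps [w] in [W]. *)
have [X wXv] : exists X, coord_row w *m X = coord_row v.
  exists (pinvmx (coord_row w) *m coord_row v); rewrite mulmxA mulmxVp ?mul1mx //.
  by rewrite /row_free rank_rV coord_row_eq0 w_n0.
have [Y XE] := word_sum_surj X det_n0.
rewrite -(coord_rowK v) -wXv XE mulmx_sumr linear_sum; apply: memv_suml => i _.
rewrite mulmx_sumr linear_sum; apply: memv_suml => j _.
rewrite -scalemxAr linearZ; apply: memvZ.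
apply: (in_W_mul) Ww; last by apply/in_W_exp/in_W_op.
by apply: in_W_mul; [apply/in_W_exp|]; apply: in_W_op.
Qed.

End Simplicity.

(** * The commutative algebra built on the cyclic shift *)

Section Witness.
Context {k : fieldType} {V : vectType k} {n : nat} (e : n.+1.-tuple V).
Hypothesis e_basis : basis_of {:V} e.

Let s : 'I_n.+1 := inZp 1.

Lemma shift_mulrn (i : 'I_n.+1) : s *+ i = i.
Proof.
by rewrite Zp_mulrn; apply: val_inj; rewrite /= modnMml mul1n modn_small.
Qed.

Let c (i j : 'I_n.+1) : V :=
  if (i == 0) || (j == 0) then e`_(i + j + s)%R else 0.

Lemma shift_word_det_neq0 (m : multiplication V) :
  (forall i j : 'I_n.+1, m e`_i e`_j = c i j) ->
  word_det (op_mx e (m e`_(0 : 'I_n.+1)%R)) (op_mx e (m e`_s)) != 0.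
Proof.
move=> mE; set A := op_mx _ _; set B := op_mx _ _.
have e_free := basis_free e_basis.
have AE i j : A i j = (j == i + s)%:R.
  by rewrite mxE mE /c eqxx add0r coord_free // eq_sym.
have BE i j : B i j = ((i == 0) && (j == s + s))%:R.
  rewrite mxE mE /c; have [->|i_n0] := eqVneq i 0.
    by rewrite orbT addr0 coord_free // eq_sym.
  (* In dimension one [s] is 0. Then every index, as a multiple of [s], is 0, against [i_n0]. *)
  case: eqP => [s0|_]; last by rewrite linear0.
  by move: i_n0; rewrite -(shift_mulrn i) s0 mul0rn eqxx.
have AXE r i j : (A ^+ r) i j = (j == i + s *+ r)%:R.
  elim: r i => [|r IH] i; first by rewrite mxE mulr0n addr0 eq_sym.
  rewrite exprS mxE (bigD1 (i + s)) //= AE eqxx mul1r IH big1 ?addr0.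
    by rewrite -addrA -mulrS.
  by move=> l /negPf l_n; rewrite AE l_n mul0r.
(* The word with exponents [a], [b] is the matrix unit at [(- a, s + s + b)]: only row 0 and column
   [s + s] of [B] contribute. *)
have wordE (a b i j : 'I_n.+1) :
    (A ^+ a *m B *m A ^+ b) i j = ((i + a == 0) && (j == s + s + b))%:R.
  rewrite mxE (bigD1 (s + s)) //= big1 ?addr0 => [|l /negPf l_n].
    rewrite mxE (bigD1 (i + a)) //= big1 ?addr0 => [|l /negPf l_n].
      by rewrite !AXE BE !shift_mulrn !eqxx mul1r andbT -natrM mulnb.
    by rewrite AXE shift_mulrn l_n mul0r.
  rewrite mxE big1 ?mul0r // => l' _.
  by rewrite BE l_n andbF mulr0.
apply: word_det_neq0 => X X0; apply/matrixP => a b; rewrite [RHS]mxE.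
(* Distinct pairs of exponents give distinct matrix units, so this entry of the word sum is exactly
   [X a b]. *)
have /matrixP/(_ (- a) (s + s + b)) := X0; rewrite [in RHS]mxE => <-.
rewrite summxE (bigD1 a) //= summxE (bigD1 b) //=.
rewrite mxE wordE addNr !eqxx mulr1 !big1 ?addr0 //.
  move=> a' /negPf a'_n; rewrite summxE big1 // => b' _.
  by rewrite mxE wordE addrC subr_eq0 a'_n mulr0.
move=> b' /negPf b'_n.
by rewrite mxE wordE (inj_eq (addrI _)) [b == _]eq_sym b'_n andbF mulr0.
Qed.

(** Bilinear extension of the table [c]. Commutativity makes left and right multiplications agree,
    so this one product serves both determinants. *)
Lemma shift_multiplication : exists m : multiplication V,
  (forall v w, m v w = m w v) /\ forall i j : 'I_n.+1, m e`_i e`_j = c i j.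
Proof.
have e_free := basis_free e_basis.
pose b v w := \sum_i \sum_j (coord e i v * coord e j w) *: c i j.
have cC i j : c i j = c j i by rewrite /c orbC [i + j]addrC.
have bC v w : b v w = b w v.
  rewrite /b exchange_big; apply: eq_bigr => i _; apply: eq_bigr => j _.
  by rewrite mulrC cC.
have bl v : linear (b v).
  move=> a x y; rewrite /b scaler_sumr -big_split; apply: eq_bigr => i _.
  rewrite scaler_sumr -big_split; apply: eq_bigr => j _.
  by rewrite linearP /= mulrDr scalerDl scalerA mulrCA.
have br w : linear (b^~ w) by move=> a x y; rewrite !(bC _ w); apply: bl.
have [m [mE _]] := multiplicationP bl br.
exists m; split=> [v w|i j]; rewrite !mE //.
rewrite /b (bigD1 i) //= (bigD1 j) //= !coord_free // !eqxx mulr1 scale1r.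
rewrite !big1 ?addr0 // => [i' /negPf i'_n|j' /negPf j'_n].
  by rewrite big1 // => j' _; rewrite coord_free // eq_sym i'_n mul0r scale0r.
by rewrite coord_free // [j == _]eq_sym j'_n mulr0 scale0r.
Qed.

End Witness.

(** * The open set where the left and right determinants are both nonzero *)

Theorem proposition5 (k : closedFieldType) (hk : [pchar k] =i pred0)
    (d : nat) (hd : (1 <= d)%N) (V : vectType k) (hV : \dim {:V} = d) :
  exists U : multiplication V -> Prop,
    [/\ zariski_open U,
        exists m, U m
      & forall m, U m -> left_simple m /\ right_simple m].
Proof.
case: d hd hV => // n _ hV.
have [e e_basis] : exists e : n.+1.-tuple V, basis_of {:V} e.
  by move: (vbasis {:V}) (vbasisP {:V}); rewrite hV => e; exists e.
have linl (m : multiplication V) v : linear (m v) by move=> a x y; rewrite linearP.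
have linr (m : multiplication V) v : linear (m^~ v).
  by move=> a x y; rewrite linearP add_lfunE scale_lfunE.
pose x := e`_(0 : 'I_n.+1)%R; pose y := e`_(inZp 1 : 'I_n.+1).
pose L (m : multiplication V) := word_det (op_mx e (m x)) (op_mx e (m y)).
pose R (m : multiplication V) := word_det (op_mx e (m^~ x)) (op_mx e (m^~ y)).
exists (fun m => L m * R m != 0); split.
(* The entries of all four operator matrices are linear forms in [m]. *)
- apply: zariski_open_neq0; apply: polynomial_functionM;
    apply: word_det_polynomial => i j; apply: polynomial_function_linear;
    by move=> a m m'; rewrite !mxE !add_lfunE !scale_lfunE linearP.
- have [m [mC mE]] := shift_multiplication e_basis; exists m.
  have L_n0 : L m != 0 by apply: shift_word_det_neq0.
  have op_mxC v : op_mx e (m^~ v) = op_mx e (m v).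
    by apply/matrixP => i j; rewrite !mxE mC.
  by rewrite /R !op_mxC mulf_neq0.
- move=> m; rewrite mulf_eq0 negb_or => /andP[L_n0 R_n0].
  split=> W idW.
  + by apply: (stable_trivial e_basis (linl m x) (linl m y) L_n0) => w;
      apply: idW.
  + by apply: (stable_trivial e_basis (linr m x) (linr m y) R_n0) => w;
      apply: idW.
Qed.
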